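(* Let $\mathcal{C}$ be a homological category and let $(\mathbf{R},\mu)$ be a radical on $\mathcal{C}$, with associated reflective subcategory $\mathcal{X}$ of objects $X$ with $\mathbf{R}(X)=0$, reflector $\mathbf{I}$ and unit $\eta$. A morphism $m:C\to C'$ of $\mathcal{C}$ lies in $(\mathbf{I}^{-1}(RegEpi\;\mathcal{X}))^{\downarrow}$ if and only if $m$ is a monomorphism and satisfies the following condition: if $D$ is a subobject of $C'$ such that the composition of the inclusion $C\cap D\rightarrowtail D$ with the morphism $\eta_D$ is a regular epimorphism, then $D\subseteq C$ (as subobjects of $C'$).
   Context: A category is homological if it is pointed, regular and protomodular. A normal monomorphism is a monomorphism that is a kernel; in a homological category every normal monomorphism $C\rightarrowtail C'$ has a cokernel, whose codomain is denoted $C'/C$. A radical on a homological category $\mathcal{C}$ is a pair $(\mathbf{R},\mu)$, where $\mathbf{R}$ is an endofunctor of $\mathcal{C}$ and $\mu:\mathbf{R}\to 1_{\mathcal{C}}$ is a natural transformation such that, for every object $C$, $\mu_C:\mathbf{R}(C)\to C$ is a normal monomorphism and $\mathbf{R}(C/\mathbf{R}(C))=0$. The full subcategory $\mathcal{X}$ of objects $X$ with $\mathbf{R}(X)=0$ is reflective in $\mathcal{C}$; the reflector is $\mathbf{I}(C)=C/\mathbf{R}(C)$ and the unit $\eta_C:C\to C/\mathbf{R}(C)$ is the cokernel of $\mu_C$. $RegEpi\;\mathcal{X}$ denotes the class of regular epimorphisms of $\mathcal{X}$, and $\mathbf{I}^{-1}(RegEpi\;\mathcal{X})$ is the class of morphisms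 $f$ of $\mathcal{C}$ with $\mathbf{I}(f)\in RegEpi\;\mathcal{X}$. For morphisms $e:A\to B$ and $m:C\to D$, write $e\downarrow m$ if for all $\alpha:A\to C$, $\beta:B\to D$ with $\beta e=m\alpha$ there is a unique $\delta:B\to C$ with $m\delta=\beta$ and $\delta e=\alpha$. For a morphism class $\mathbb{N}$, $\mathbb{N}^{\downarrow}$ is the class of all morphisms $f$ with $n\downarrow f$ for all $n\in\mathbb{N}$. $C\cap D$ is the intersection (pullback) of subobjects. *)

(* Defs.v *)
From Stdlib Require Import ClassicalEpsilon.

Set Implicit Arguments.
Unset Strict Implicit.
Unset Printing Implicit Defensive.

Declare Scope cat_scope.
Delimit Scope cat_scope with cat.
Open Scope cat_scope.

(* Equality of morphisms is Leibniz equality. *)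
Record category := Category {
  Obj :> Type;
  Hom : Obj -> Obj -> Type;
  idm : forall A, Hom A A;
  comp : forall A B C, Hom B C -> Hom A B -> Hom A C;
  comp_id_l : forall A B (f : Hom A B), comp (idm B) f = f;
  comp_id_r : forall A B (f : Hom A B), comp f (idm A) = f;
  comp_assoc : forall A B C D (h : Hom C D) (g : Hom B C) (f : Hom A B),
    comp h (comp g f) = comp (comp h g) f
}.

Arguments Hom {c} A B.
Arguments idm {c} A.
Arguments comp {c A B C} g f.

Notation "g ∘ f" := (comp g f) (at level 40, left associativity) : cat_scope.

Record functor (C D : category) := Functor {
  fobj :> C -> D;
  fmap : forall A B : C, Hom A B -> Hom (fobj A) (fobj B);
  fmap_id : forall A : C, fmap (idm A) = idm (fobj A);
  fmap_comp : forall (X Y Z : C) (g : Hom Y Z) (f : Hom X Y),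
    fmap (g ∘ f) = fmap g ∘ fmap f
}.

Arguments fmap {C D} F {A B} f : rename.

Definition id_functor (C : category) : functor C C :=
  @Functor C C (fun A => A) (fun A B f => f)
    (fun A => eq_refl) (fun X Y Z g f => eq_refl).

Record nat_trans (C D : category) (F G : functor C D) := NatTrans {
  component :> forall A : C, Hom (F A) (G A);
  naturality : forall (A B : C) (f : Hom A B),
    component B ∘ fmap F f = fmap G f ∘ component A
}.

Definition full_subcategory (C : category) (P : C -> Prop) : category :=
  @Category {A : C | P A}
    (fun A B => Hom (proj1_sig A) (proj1_sig B))
    (fun A => idm (proj1_sig A))
    (fun A B D g f => g ∘ f)
    (fun A B f => comp_id_l f)
    (fun A B f => comp_id_r f)
    (fun A B D E h g f => comp_assoc h g f).

Definition morphism_class (C : category) := forall A B : C, Hom A B -> Prop.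

Section Notions.
Variable C : category.

Definition is_mono (A B : C) (m : Hom A B) : Prop :=
  forall (T : C) (x y : Hom T A), m ∘ x = m ∘ y -> x = y.

Definition is_iso (A B : C) (f : Hom A B) : Prop :=
  exists g : Hom B A, g ∘ f = idm A /\ f ∘ g = idm B.

Definition is_initial (Z : C) : Prop :=
  forall A : C, exists f : Hom Z A, forall g : Hom Z A, g = f.

Definition is_terminal (Z : C) : Prop :=
  forall A : C, exists f : Hom A Z, forall g : Hom A Z, g = f.

Definition is_zero_obj (Z : C) : Prop := is_initial Z /\ is_terminal Z.

Definition is_zero_mor (A B : C) (f : Hom A B) : Prop :=
  exists (Z : C) (t : Hom A Z) (i : Hom Z B), is_zero_obj Z /\ f = i ∘ t.

Definition is_pullback (A B D P : C) (f : Hom A D) (g : Hom B D)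
    (p1 : Hom P A) (p2 : Hom P B) : Prop :=
  f ∘ p1 = g ∘ p2 /\
  forall (T : C) (x : Hom T A) (y : Hom T B), f ∘ x = g ∘ y ->
    exists! t : Hom T P, p1 ∘ t = x /\ p2 ∘ t = y.

Definition is_coequalizer (A B Q : C) (u v : Hom A B) (q : Hom B Q) : Prop :=
  q ∘ u = q ∘ v /\
  forall (T : C) (x : Hom B T), x ∘ u = x ∘ v ->
    exists! t : Hom Q T, t ∘ q = x.

Definition is_regular_epi (B Q : C) (q : Hom B Q) : Prop :=
  exists (A : C) (u v : Hom A B), is_coequalizer u v q.

Definition is_kernel (K A B : C) (f : Hom A B) (k : Hom K A) : Prop :=
  is_zero_mor (f ∘ k) /\
  forall (T : C) (x : Hom T A), is_zero_mor (f ∘ x) ->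
    exists! t : Hom T K, k ∘ t = x.

Definition is_cokernel (A B Q : C) (f : Hom A B) (q : Hom B Q) : Prop :=
  is_zero_mor (q ∘ f) /\
  forall (T : C) (x : Hom B T), is_zero_mor (x ∘ f) ->
    exists! t : Hom Q T, t ∘ q = x.

Definition is_normal_mono (K A : C) (k : Hom K A) : Prop :=
  is_mono k /\ exists (B : C) (f : Hom A B), is_kernel f k.

(* For monomorphisms d and m, the order of the subobjects they represent. *)
Definition sub_le (A B D : C) (d : Hom D B) (m : Hom A B) : Prop :=
  exists h : Hom D A, m ∘ h = d.

Definition is_pointed : Prop := exists Z : C, is_zero_obj Z.

Definition has_pullbacks : Prop :=
  forall (A B D : C) (f : Hom A D) (g : Hom B D),
    exists (P : C) (p1 : Hom P A) (p2 : Hom P B), is_pullback f g p1 p2.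

(* Finite completeness is given by a terminal object and pullbacks. *)
Definition finitely_complete : Prop :=
  (exists Z : C, is_terminal Z) /\ has_pullbacks.

Definition kernel_pairs_have_coequalizers : Prop :=
  forall (A B P : C) (f : Hom A B) (p1 p2 : Hom P A),
    is_pullback f f p1 p2 ->
    exists (Q : C) (q : Hom A Q), is_coequalizer p1 p2 q.

Definition regular_epis_pullback_stable : Prop :=
  forall (A B D P : C) (f : Hom A D) (g : Hom B D)
      (p1 : Hom P A) (p2 : Hom P B),
    is_pullback f g p1 p2 -> is_regular_epi g -> is_regular_epi p1.

Definition is_regular : Prop :=
  finitely_complete /\ kernel_pairs_have_coequalizers /\
  regular_epis_pullback_stable.

(* An object of the category Pt(B): a split epimorphism onto B together with
   a chosen splitting. *)
Record point (B : C) := Point {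
  pt_obj : C;
  pt_proj : Hom pt_obj B;
  pt_sect : Hom B pt_obj;
  pt_split : pt_proj ∘ pt_sect = idm B
}.

Definition is_point_mor (B : C) (X Y : point B)
    (f : Hom (pt_obj X) (pt_obj Y)) : Prop :=
  pt_proj Y ∘ f = pt_proj X /\ f ∘ pt_sect X = pt_sect Y.

(* Every change-of-base functor v^* : Pt(B) -> Pt(A) reflects isomorphisms.
   The arrow g below is v^*(f): it is determined by the two equations, which
   also make it compatible with the induced sections, and it is invertible in
   Pt(A) exactly when it is invertible in C; likewise for f in Pt(B). *)
Definition is_protomodular : Prop :=
  forall (A B : C) (v : Hom A B) (X Y : point B)
      (f : Hom (pt_obj X) (pt_obj Y)), is_point_mor f ->
  forall (P : C) (p1 : Hom P A) (p2 : Hom P (pt_obj X)),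
    is_pullback v (pt_proj X) p1 p2 ->
  forall (Q : C) (q1 : Hom Q A) (q2 : Hom Q (pt_obj Y)),
    is_pullback v (pt_proj Y) q1 q2 ->
  forall g : Hom P Q, q1 ∘ g = p1 -> q2 ∘ g = f ∘ p2 ->
    is_iso g -> is_iso f.

Definition homological : Prop := is_pointed /\ is_regular /\ is_protomodular.

Definition orthogonal (A B X Y : C) (e : Hom A B) (m : Hom X Y) : Prop :=
  forall (a : Hom A X) (b : Hom B Y), b ∘ e = m ∘ a ->
    exists! d : Hom B X, m ∘ d = b /\ d ∘ e = a.

Definition right_orthogonal (N : morphism_class C) : morphism_class C :=
  fun X Y f => forall (A B : C) (n : Hom A B), N A B n -> orthogonal n f.

Definition RegEpi : morphism_class C := fun A B f => is_regular_epi f.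

Lemma zero_mor_comp_l (A B D : C) (g : Hom B D) (f : Hom A B) :
  is_zero_mor f -> is_zero_mor (g ∘ f).
Proof.
  intros [Z [t [i [hZ ->]]]]. exists Z, t, (g ∘ i). split; auto.
  apply comp_assoc.
Qed.

Lemma zero_mor_comp_r (A B D : C) (g : Hom B D) (f : Hom A B) :
  is_zero_mor g -> is_zero_mor (g ∘ f).
Proof.
  intros [Z [t [i [hZ ->]]]]. exists Z, (t ∘ f), i. split; auto.
  symmetry; apply comp_assoc.
Qed.

Lemma zero_mor_unique (A B : C) (f g : Hom A B) :
  is_zero_mor f -> is_zero_mor g -> f = g.
Proof.
  intros [Z [t [i [[hZi hZt] ->]]]] [Z' [t' [i' [[hZi' hZt'] ->]]]].
  destruct (hZi Z') as [c _].
  destruct (hZi B) as [b hb]. destruct (hZt' A) as [a ha].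
  rewrite (hb i), <- (hb (i' ∘ c)), (ha t'), <- (ha (c ∘ t)).
  symmetry; apply comp_assoc.
Qed.

Lemma zero_mor_exists (A B : C) :
  is_pointed -> exists f : Hom A B, is_zero_mor f.
Proof.
  intros [Z hZ]. destruct (proj1 hZ B) as [i _], (proj2 hZ A) as [t _].
  exists (i ∘ t), Z, t, i. auto.
Qed.

Lemma finitely_complete_equalizer (A B : C) (u v : Hom A B) :
  finitely_complete ->
  exists (E : C) (e : Hom E A), u ∘ e = v ∘ e /\ is_mono e /\
    forall (T : C) (x : Hom T A), u ∘ x = v ∘ x ->
      exists t : Hom T E, e ∘ t = x.
Proof.
  intros [[Z hZ] hpb].
  destruct (hZ A) as [a _], (hZ B) as [b _].
  destruct (hpb A B Z a b) as [P [p1 [p2 [_ hP]]]].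
  assert (term : forall T (x y : Hom T Z), x = y).
  { intros T x y. destruct (hZ T) as [t ht].
    now rewrite (ht x), (ht y). }
  assert (jm : forall T (x y : Hom T P),
             p1 ∘ x = p1 ∘ y -> p2 ∘ x = p2 ∘ y -> x = y).
  { intros T x y h1 h2.
    destruct (hP T (p1 ∘ y) (p2 ∘ y) (term _ _ _)) as [t [_ ht]].
    rewrite <- (ht x (conj h1 h2)). apply ht; auto. }
  destruct (hP A (idm A) u (term _ _ _)) as [gu [[gu1 gu2] _]].
  destruct (hP A (idm A) v (term _ _ _)) as [gv [[gv1 gv2] _]].
  destruct (hpb A A P gu gv) as [E [e [e' [he hE]]]].
  assert (ee : e = e').
  { rewrite <- (comp_id_l e), <- (comp_id_l e'), <- gu1 at 1.
    rewrite <- gv1, <- !comp_assoc. now rewrite he. }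
  subst e'.
  exists E, e. split; [|split].
  - rewrite <- gu2, <- gv2, <- !comp_assoc. now rewrite he.
  - intros T x y hxy.
    destruct (hE T (e ∘ y) (e ∘ y)) as [t [_ ht]].
    { now rewrite !comp_assoc, he. }
    rewrite <- (ht x (conj hxy hxy)). apply ht; auto.
  - intros T x hx.
    destruct (hE T x x) as [t [[ht _] _]].
    { apply jm; rewrite !comp_assoc.
      - now rewrite gu1, gv1.
      - now rewrite gu2, gv2. }
    now exists t.
Qed.

(* If k is the kernel of f, its cokernel is the coequalizer q of the kernel
   pair of f.  Protomodularity, applied along 0 -> A, forces the equalizer of
   x p1 and x p2 to be the whole kernel pair whenever x k = 0. *)
Lemma normal_mono_has_cokernel (K A : C) (k : Hom K A) :
  homological -> is_normal_mono k ->
  exists (Q : C) (q : Hom A Q), is_cokernel k q.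
Proof.
  intros [hpt [[hfc [hco _]] hproto]] [_ [B [f [hfk hk]]]].
  destruct (proj2 hfc A A B f f) as [P [p1 [p2 hP]]].
  destruct (hco _ _ _ _ _ _ hP) as [Q [q [hq hQ]]].
  destruct hP as [hp hP].
  assert (jm : forall T (x y : Hom T P),
             p1 ∘ x = p1 ∘ y -> p2 ∘ x = p2 ∘ y -> x = y).
  { intros T x y h1 h2.
    destruct (hP T (p1 ∘ y) (p2 ∘ y)) as [t [_ ht]].
    { now rewrite !comp_assoc, hp. }
    rewrite <- (ht x (conj h1 h2)). apply ht; auto. }
  destruct (zero_mor_exists K A hpt) as [o ho].
  destruct (hP K k o) as [j [[hj1 hj2] _]].
  { apply zero_mor_unique; auto. now apply zero_mor_comp_l. }
  destruct (hP A (idm A) (idm A) eq_refl) as [s [[hs1 hs2] _]].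
  exists Q, q. split.
  { rewrite <- hj1, comp_assoc, hq, <- comp_assoc, hj2.
    now apply zero_mor_comp_l. }
  intros T x hx. apply hQ.
  destruct (finitely_complete_equalizer (x ∘ p1) (x ∘ p2) hfc)
    as [E [e [he [me hE]]]].
  destruct (hE A s) as [s' hs'].
  { now rewrite <- !comp_assoc, hs1, hs2. }
  destruct (hE K j) as [j' hj'].
  { rewrite <- !comp_assoc, hj1, hj2.
    apply zero_mor_unique; auto. now apply zero_mor_comp_l. }
  assert (hs2' : (p2 ∘ e) ∘ s' = idm A).
  { now rewrite <- comp_assoc, hs'. }
  destruct hpt as [Z hZ].
  destruct (proj1 hZ A) as [v _], (proj2 hZ K) as [w _].
  assert (term : forall U (a b : Hom U Z), a = b).
  { intros U a b. destruct (proj2 hZ U) as [c hc].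
    now rewrite (hc a), (hc b). }
  assert (hvw : v ∘ w = o).
  { apply zero_mor_unique; auto. exists Z, w, v; auto. }
  assert (key : forall U (z : Hom U Z) (y : Hom U P), v ∘ z = p2 ∘ y ->
             exists t : Hom U K, j ∘ t = y).
  { intros U z y hzy.
    assert (hzero : is_zero_mor (p2 ∘ y)).
    { rewrite <- hzy. exists Z, z, v; auto. }
    destruct (hk U (p1 ∘ y)) as [t [ht _]].
    { rewrite comp_assoc, hp, <- comp_assoc. now apply zero_mor_comp_l. }
    exists t. apply jm; rewrite comp_assoc.
    - now rewrite hj1.
    - rewrite hj2. apply zero_mor_unique; auto. now apply zero_mor_comp_r. }
  assert (mj : is_mono j).
  { intros U a b hab.
    destruct (hk U (k ∘ b)) as [t [_ ht]].
    { rewrite comp_assoc. now apply zero_mor_comp_r. }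
    rewrite <- (ht a); [apply ht; auto|].
    now rewrite <- hj1, <- !comp_assoc, hab. }
  assert (ie : is_iso e).
  { apply (hproto Z A v (Point hs2') (Point hs2) e) with
      (P := K) (p1 := w) (p2 := j') (Q := K) (q1 := w) (q2 := j) (g := idm K);
      simpl.
    - split; simpl; auto.
    - split; [now rewrite <- comp_assoc, hj', hj2|].
      intros U z y hzy. rewrite <- comp_assoc in hzy.
      destruct (key U z (e ∘ y) hzy) as [t ht].
      assert (ht' : j' ∘ t = y).
      { apply me. now rewrite comp_assoc, hj'. }
      exists t. split; [split; auto|].
      intros t' [_ ht'']. apply mj. rewrite ht, <- ht'', comp_assoc, hj'.
      reflexivity.
    - split; [now rewrite hj2|].
      intros U z y hzy. destruct (key U z y hzy) as [t ht].
      exists t. split; [split; auto|].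
      intros t' [_ ht']. apply mj. now rewrite ht, ht'.
    - apply comp_id_r.
    - now rewrite comp_id_r, hj'.
    - exists (idm K). split; apply comp_id_l. }
  destruct ie as [e' [_ hee']].
  rewrite <- (comp_id_r (x ∘ p1)), <- (comp_id_r (x ∘ p2)), <- hee'.
  now rewrite !comp_assoc, he.
Qed.

Section Quotient.
Variables (hC : homological) (K A : C) (k : Hom K A) (hk : is_normal_mono k).

Definition chosen_cokernel : {Q : C | exists q : Hom A Q, is_cokernel k q} :=
  constructive_indefinite_description _ (normal_mono_has_cokernel hC hk).

(* The object A/K. *)
Definition quotient : C := proj1_sig chosen_cokernel.

Definition quotient_map : Hom A quotient :=
  proj1_sig (constructive_indefinite_description _ (proj2_sig chosen_cokernel)).

Lemma quotient_map_cokernel : is_cokernel k quotient_map.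
Proof.
  exact (proj2_sig
    (constructive_indefinite_description _ (proj2_sig chosen_cokernel))).
Qed.

Lemma quotient_map_epi (T : C) (x y : Hom quotient T) :
  x ∘ quotient_map = y ∘ quotient_map -> x = y.
Proof.
  intros hxy. destruct quotient_map_cokernel as [h0 hu].
  destruct (hu T (y ∘ quotient_map)) as [t [_ ht]].
  { rewrite <- comp_assoc. now apply zero_mor_comp_l. }
  rewrite <- (ht x hxy). now apply ht.
Qed.

End Quotient.

(* R(A/R(A)) = 0 is read as: R(A/R(A)) is a zero object. *)
Record radical (hC : homological) := Radical {
  rad : functor C C;
  rad_mu : nat_trans rad (id_functor C);
  rad_normal : forall A : C, is_normal_mono (rad_mu A);
  rad_quotient : forall A : C, is_zero_obj (rad (quotient hC (rad_normal A)))
}.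

Section Reflection.
Variables (hC : homological) (R : radical hC).

Definition torsion_free (X : C) : Prop := is_zero_obj (rad R X).

Definition reflective_subcategory : category := full_subcategory torsion_free.

Definition refl_obj (A : C) : reflective_subcategory :=
  exist torsion_free (quotient hC (rad_normal R A)) (rad_quotient R A).

Definition eta (A : C) : Hom A (proj1_sig (refl_obj A)) :=
  quotient_map hC (rad_normal R A).

Lemma eta_universal (A X : C) (f : Hom A X) : torsion_free X ->
  exists! g : Hom (proj1_sig (refl_obj A)) X, g ∘ eta A = f.
Proof.
  intros hX. apply (quotient_map_cokernel hC (rad_normal R A)).
  change (is_zero_mor (fmap (id_functor C) f ∘ rad_mu R A)).
  rewrite <- naturality.
  exists (rad R X), (fmap (rad R) f), (rad_mu R X). auto.
Qed.

Definition refl_map_sig (A B : C) (f : Hom A B) :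
    {g : Hom (proj1_sig (refl_obj A)) (proj1_sig (refl_obj B)) |
      g ∘ eta A = eta B ∘ f} :=
  constructive_indefinite_description _
    (match eta_universal (eta B ∘ f) (proj2_sig (refl_obj B)) with
     | ex_intro _ g (conj hg _) => ex_intro _ g hg
     end).

(* I(f) is the unique morphism with I(f) eta_A = eta_B f. *)
Definition refl_map (A B : C) (f : Hom A B) :
    @Hom reflective_subcategory (refl_obj A) (refl_obj B) :=
  proj1_sig (refl_map_sig f).

Lemma refl_map_eta (A B : C) (f : Hom A B) :
  @comp C _ _ _ (refl_map f) (eta A) = eta B ∘ f.
Proof. exact (proj2_sig (refl_map_sig f)). Qed.

Lemma refl_map_id (A : C) : refl_map (idm A) = idm (refl_obj A).
Proof.
  apply (@quotient_map_epi hC _ _ _ (rad_normal R A)).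
  change (@comp C _ _ _ (refl_map (idm A)) (eta A) =
          @comp C _ _ _ (idm (proj1_sig (refl_obj A))) (eta A)).
  now rewrite refl_map_eta, comp_id_r, comp_id_l.
Qed.

Lemma refl_map_comp (X Y Z : C) (g : Hom Y Z) (f : Hom X Y) :
  refl_map (g ∘ f) = refl_map g ∘ refl_map f.
Proof.
  apply (@quotient_map_epi hC _ _ _ (rad_normal R X)).
  change (@comp C _ _ _ (refl_map (g ∘ f)) (eta X) =
          @comp C _ _ _ (@comp C _ _ _ (refl_map g) (refl_map f)) (eta X)).
  now rewrite <- comp_assoc, !refl_map_eta, !comp_assoc, refl_map_eta.
Qed.

Definition reflector : functor C reflective_subcategory :=
  Functor refl_map_id refl_map_comp.

End Reflection.
End Notions.

Arguments RegEpi C : clear implicits.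

Definition inverse_image (C D : category) (F : functor C D)
    (N : morphism_class D) : morphism_class C :=
  fun A B f => N (F A) (F B) (fmap F f).

(* For a subobject d of B, the object P with its maps to A and D is the
   intersection of the subobjects m and d. *)
Definition radical_condition (C : category) (hC : homological C)
    (R : radical hC) (A B : C) (m : Hom A B) : Prop :=
  forall (D : C) (d : Hom D B), is_mono d ->
  forall (P : C) (pA : Hom P A) (pD : Hom P D), is_pullback m d pA pD ->
    is_regular_epi (eta R D ∘ pD) -> sub_le d m.

(* Main.v *)
Require Import Defs.

(** Regular epimorphisms of a regular category coincide with strong ones
    (those having the lifting property against monomorphisms), and strong
    epimorphisms compose and are cancellable on the right.  A morphism of the
    reflective subcategory X is a regular epimorphism in X iff it is one in C,
    because X is closed under subobjects.

    If [m : A -> B] is orthogonal to I^-1(RegEpi X), testing it on the regular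
    epimorphism of its image factorization shows that it is mono, and testing it
    on [A ∩ D -> D] gives the condition on subobjects.  Conversely, to lift
    [b : T -> B] through the mono [m] against [e], take for [D] the image of
    [b], with [q : T -> D]: the composite of [e] with [T -> D -> I(D)] factors
    through [A ∩ D], and equals I(q) I(e) eta, which is a strong epimorphism. *)

Set Implicit Arguments.
Unset Strict Implicit.
Unset Printing Implicit Defensive.

Section RegularCategories.
Variable C : category.

Definition is_epi (A B : C) (e : Hom A B) : Prop :=
  forall (T : C) (x y : Hom B T), x ∘ e = y ∘ e -> x = y.

(* The other triangle and uniqueness are automatic when [m] is mono. *)
Definition is_strong_epi (A B : C) (e : Hom A B) : Prop :=
  forall (X Y : C) (m : Hom X Y), is_mono m ->
  forall (a : Hom A X) (b : Hom B Y), b ∘ e = m ∘ a ->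
    exists d : Hom B X, m ∘ d = b.

Lemma regular_epi_epi (A B : C) (e : Hom A B) : is_regular_epi e -> is_epi e.
Proof.
  intros [U [u [v [huv he]]]] T x y hxy.
  destruct (he T (y ∘ e)) as [t [_ ht]].
  { now rewrite <- !comp_assoc, huv. }
  rewrite <- (ht x hxy). now apply ht.
Qed.

Lemma regular_epi_strong (A B : C) (e : Hom A B) :
  is_regular_epi e -> is_strong_epi e.
Proof.
  intros he X Y m hm a b hab.
  assert (epi_e := regular_epi_epi he).
  destruct he as [U [u [v [huv he]]]].
  destruct (he X a) as [d [hd _]].
  { apply hm. now rewrite !comp_assoc, <- hab, <- !comp_assoc, huv. }
  exists d. apply epi_e. now rewrite <- comp_assoc, hd.
Qed.

Lemma strong_epi_comp (A B D : C) (g : Hom B D) (f : Hom A B) :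
  is_strong_epi g -> is_strong_epi f -> is_strong_epi (g ∘ f).
Proof.
  intros hg hf X Y m hm a b hab.
  rewrite comp_assoc in hab.
  destruct (hf X Y m hm a (b ∘ g) hab) as [d hd].
  now apply (hg X Y m hm d).
Qed.

Lemma strong_epi_cancel (A B D : C) (g : Hom B D) (f : Hom A B) :
  is_strong_epi (g ∘ f) -> is_strong_epi g.
Proof.
  intros hgf X Y m hm a b hab.
  apply (hgf X Y m hm (a ∘ f)). now rewrite !comp_assoc, hab.
Qed.

(** If [g ∘ f] is the coequalizer of [u] and [v], then [g] is the coequalizer of [f ∘ u] and
    [f ∘ v]. *)
Lemma regular_epi_cancel (A B D : C) (g : Hom B D) (f : Hom A B) :
  is_epi f -> is_regular_epi (g ∘ f) -> is_regular_epi g.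
Proof.
  intros hf [U [u [v [huv hgf]]]].
  exists U, (f ∘ u), (f ∘ v). split.
  { now rewrite !comp_assoc. }
  intros T x hx. rewrite !comp_assoc in hx.
  destruct (hgf T (x ∘ f) hx) as [t [ht ut]].
  exists t. split.
  { apply hf. now rewrite <- comp_assoc. }
  intros t' <-. apply ut. apply comp_assoc.
Qed.

Lemma regular_epi_comp_iso (A B D : C) (i : Hom B D) (q : Hom A B) :
  is_iso i -> is_regular_epi q -> is_regular_epi (i ∘ q).
Proof.
  intros [j [hji hij]] [U [u [v [huv hq]]]].
  exists U, u, v. split.
  { now rewrite <- !comp_assoc, huv. }
  intros T x hx. destruct (hq T x hx) as [t [ht ut]].
  exists (t ∘ j). split.
  { rewrite comp_assoc, <- (comp_assoc t), hji. now rewrite comp_id_r. }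
  intros t' ht'. rewrite (ut (t' ∘ i)).
  - now rewrite <- comp_assoc, hij, comp_id_r.
  - now rewrite <- comp_assoc.
Qed.

(* Given [i x = i y], cover the common domain by regular epimorphisms along
   which [x] and [y] lift through [q]. *)
Lemma regular_epi_mono_factorization (A B : C) (f : Hom A B) :
  is_regular C ->
  exists (D : C) (q : Hom A D) (i : Hom D B),
    is_regular_epi q /\ is_mono i /\ i ∘ q = f.
Proof.
  intros [[_ hpb] [hco hst]].
  destruct (hpb A A B f f) as [P [p1 [p2 hP]]].
  destruct (hco _ _ _ _ _ _ hP) as [D [q hq]].
  destruct hP as [hp hP].
  destruct (proj2 hq B f hp) as [i [hi _]].
  assert (rq : is_regular_epi q) by (exists P, p1, p2; exact hq).
  exists D, q, i. split; [exact rq|split; [|exact hi]].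
  intros T x y hxy.
  destruct (hpb _ _ _ x q) as [T1 [x' [a1 h1]]].
  destruct (hpb _ _ _ (y ∘ x') q) as [T2 [y' [a2 h2]]].
  apply (regular_epi_epi (hst _ _ _ _ _ _ _ _ h1 rq)).
  apply (regular_epi_epi (hst _ _ _ _ _ _ _ _ h2 rq)).
  destruct h1 as [h1 _], h2 as [h2 _].
  destruct (hP T2 (a1 ∘ y') a2) as [w [[hw1 hw2] _]].
  { rewrite <- hi, comp_assoc, <- (comp_assoc i q a1), <- h1.
    now rewrite <- (comp_assoc i q a2), <- h2, !comp_assoc, hxy. }
  rewrite h1, h2, <- comp_assoc, <- hw1, <- hw2, !comp_assoc.
  now rewrite (proj1 hq).
Qed.

(** Lifting the identity of [B] through the mono part [i] of the image factorization splits [i], so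
    [i] is invertible. *)
Lemma strong_epi_regular (A B : C) (e : Hom A B) :
  is_regular C -> is_strong_epi e -> is_regular_epi e.
Proof.
  intros hC he.
  destruct (regular_epi_mono_factorization e hC) as [D [q [i [hq [hi hiq]]]]].
  destruct (he _ _ i hi q (idm B)) as [s hs].
  { now rewrite comp_id_l. }
  rewrite <- hiq. apply regular_epi_comp_iso; [|exact hq].
  exists s. split; [|exact hs].
  apply hi. now rewrite comp_assoc, hs, comp_id_l, comp_id_r.
Qed.

Lemma cokernel_regular_epi (K A Q : C) (k : Hom K A) (q : Hom A Q) :
  is_pointed C -> is_cokernel k q -> is_regular_epi q.
Proof.
  intros hpt [h0 hq].
  destruct (zero_mor_exists K A hpt) as [o ho].
  exists K, k, o. split.
  { apply zero_mor_unique; [exact h0|now apply zero_mor_comp_l]. }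
  intros T x hx. apply hq. rewrite hx. now apply zero_mor_comp_l.
Qed.

(** Cancelling [k] shows that the identity of [K] is zero, so [K] is isomorphic to a zero object. *)
Lemma zero_mono_domain (K A : C) (k : Hom K A) :
  is_mono k -> is_zero_mor k -> is_zero_obj K.
Proof.
  intros hk [Z [t [i [hZ hki]]]].
  destruct (proj1 hZ K) as [z _].
  assert (hid : z ∘ t = idm K).
  { apply hk. apply zero_mor_unique.
    - apply zero_mor_comp_l. exists Z, t, z. auto.
    - rewrite comp_id_r. exists Z, t, i. auto. }
  split; intros X.
  - destruct (proj1 hZ X) as [f hf]. exists (f ∘ t). intros g.
    rewrite <- (comp_id_r g), <- hid, comp_assoc. now rewrite (hf (g ∘ z)).
  - destruct (proj2 hZ X) as [f hf]. exists (z ∘ f). intros g.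
    rewrite <- (comp_id_l g), <- hid, <- comp_assoc. now rewrite (hf (t ∘ g)).
Qed.

End RegularCategories.

Section Radicals.
Variables (C : category) (hC : homological C) (R : radical hC).

Lemma eta_regular_epi (A : C) : is_regular_epi (eta R A).
Proof.
  exact (cokernel_regular_epi (proj1 hC)
           (quotient_map_cokernel hC (rad_normal R A))).
Qed.

(** By naturality of the radical, the mono [m ∘ rad_mu R A] factors through R(B) = 0. *)
Lemma torsion_free_subobject (A B : C) (m : Hom A B) :
  is_mono m -> torsion_free R B -> torsion_free R A.
Proof.
  intros hm hB. unfold torsion_free.
  destruct (rad_normal R A) as [hmu _].
  apply (@zero_mono_domain C _ _ (m ∘ rad_mu R A)).
  - intros T x y hxy. apply hmu, hm. now rewrite !comp_assoc.
  - change (is_zero_mor (fmap (id_functor C) m ∘ rad_mu R A)).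
    rewrite <- naturality.
    exists (rad R B), (fmap (rad R) m), (rad_mu R B). auto.
Qed.

(** The domain [U] of the coequalized pair may lie outside the subcategory; factoring the pair
    through [eta R U] moves it to I(U). *)
Lemma regular_epi_in_reflective (X Y : reflective_subcategory R)
    (g : Hom X Y) :
  is_regular_epi (C := C) g -> is_regular_epi g.
Proof.
  intros [U [u [v [huv hg]]]].
  destruct (eta_universal u (proj2_sig X)) as [u' [hu _]].
  destruct (eta_universal v (proj2_sig X)) as [v' [hv _]].
  exists (refl_obj R U), u', v'. split.
  - apply (regular_epi_epi (eta_regular_epi U)).
    change ((@comp C _ _ _ (@comp C _ _ _ g u') (eta R U)) =
            (@comp C _ _ _ (@comp C _ _ _ g v') (eta R U))).
    now rewrite <- !comp_assoc, hu, hv.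
  - intros T x hx. apply (hg (proj1_sig T) x).
    rewrite <- hu, <- hv, !comp_assoc.
    now apply (f_equal (fun h => @comp C _ _ _ h (eta R U))).
Qed.

Lemma reflective_regular_epi_strong (X Y : reflective_subcategory R)
    (g : Hom X Y) :
  is_regular_epi g -> is_strong_epi (C := C) g.
Proof.
  intros hg S T m hm a b hab.
  assert (epi_g := regular_epi_epi hg).
  destruct hg as [U [u [v [huv hg]]]].
  destruct (@regular_epi_mono_factorization C _ _ g (proj1 (proj2 hC)))
    as [Z [p [i [hp [hi hip]]]]].
  (* The image of [g] in [C] is a subobject of [Y], hence torsion-free, so the universal property of
     [g] in the subcategory applies to [p] and yields a section of [i]. *)
  pose (Z' := exist _ Z (torsion_free_subobject hi (proj2_sig Y))
              : reflective_subcategory R).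
  destruct (hg Z' p) as [s [hs _]].
  { apply hi. change (@comp C _ _ _ i (@comp C _ _ _ p u) =
                      @comp C _ _ _ i (@comp C _ _ _ p v)).
    rewrite !comp_assoc, hip. exact huv. }
  assert (his : @comp C _ _ _ i s = idm (proj1_sig Y)).
  { apply (epi_g Y).
    change (@comp C _ _ _ (@comp C _ _ _ i s) g =
            @comp C _ _ _ (idm (proj1_sig Y)) g).
    rewrite <- comp_assoc, comp_id_l.
    exact (eq_trans (f_equal (comp i) hs) hip). }
  destruct (regular_epi_strong hp hm (a := a) (b := b ∘ i)) as [d hd].
  { now rewrite <- comp_assoc, hip. }
  exists (@comp C _ _ _ d s).
  now rewrite comp_assoc, hd, <- comp_assoc, his, comp_id_r.
Qed.

(** Since I(f) [∘ eta R A] equals [eta R B ∘ f], cancelling the epi [eta R A] makes I(f) regular epi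
    in [C], hence in the subcategory. *)
Lemma inverse_image_of_eta_regular_epi (A B : C) (f : Hom A B) :
  is_regular_epi (eta R B ∘ f) ->
  inverse_image (reflector R) (RegEpi (reflective_subcategory R)) f.
Proof.
  intros hf. apply regular_epi_in_reflective.
  apply (regular_epi_cancel (regular_epi_epi (eta_regular_epi A))).
  change (is_regular_epi (@comp C _ _ _ (refl_map R f) (eta R A))).
  now rewrite refl_map_eta.
Qed.

Lemma regular_epi_eta_comp (A B : C) (f : Hom A B) :
  is_regular_epi f -> is_regular_epi (eta R B ∘ f).
Proof.
  intros hf. apply strong_epi_regular; [exact (proj1 (proj2 hC))|].
  apply strong_epi_comp; apply regular_epi_strong; auto using eta_regular_epi.
Qed.

End Radicals.

Theorem proposition4p3 (C : category) (hC : homological C) (R : radical hC)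
    (A B : C) (m : Hom A B) :
  right_orthogonal
    (inverse_image (reflector R) (RegEpi (reflective_subcategory R))) m
  <-> is_mono m /\ radical_condition R m.
Proof.
  assert (hreg := proj1 (proj2 hC)).
  split.
  - intros hm. split.
    + destruct (regular_epi_mono_factorization m hreg)
        as [D [q [i [hq [hi hiq]]]]].
      (* The diagonal [d] satisfies [d ∘ q = idm A], so [q] is a split mono and [m = i ∘ q] is
         mono. *)
      destruct (hm _ _ q (inverse_image_of_eta_regular_epi
                            (regular_epi_eta_comp R hq)) (idm A) i)
        as [d [[_ hd] _]].
      { now rewrite comp_id_r. }
      intros T x y hxy. rewrite <- hiq, <- !comp_assoc in hxy.
      rewrite <- (comp_id_l x), <- (comp_id_l y), <- hd, <- !comp_assoc.
      now rewrite (hi _ _ _ hxy).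
    + intros D d _ P pA pD [hp _] hreg_epi.
      destruct (hm _ _ pD (inverse_image_of_eta_regular_epi hreg_epi) pA d)
        as [h [[hh _] _]]; [now symmetry|].
      now exists h.
  - intros [hm hcond] S T e he a b hab.
    destruct (regular_epi_mono_factorization b hreg)
      as [D [q [d [hq [hd hdq]]]]].
    destruct (proj2 (proj1 hreg) _ _ _ m d) as [P [pA [pD hP]]].
    destruct (proj2 hP S a (q ∘ e)) as [t [[_ ht] _]].
    { now rewrite comp_assoc, hdq. }
    destruct (hcond D d hd P pA pD hP) as [h hh].
    { apply strong_epi_regular; [exact hreg|].
      (* Precomposing [eta R D ∘ pD] with [t] gives [eta R D ∘ q ∘ e], which naturality of [eta]
         turns into I(q) I(e) [eta R S]. *)
      apply (strong_epi_cancel (f := t)).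
      rewrite <- comp_assoc, ht, comp_assoc, <- refl_map_eta, <- comp_assoc.
      rewrite <- (refl_map_eta R e).
      apply strong_epi_comp; [|apply strong_epi_comp].
      - apply (strong_epi_cancel (f := eta R T)). rewrite refl_map_eta.
        now apply regular_epi_strong, regular_epi_eta_comp.
      - now apply reflective_regular_epi_strong.
      - apply regular_epi_strong, eta_regular_epi. }
    assert (hb : m ∘ (h ∘ q) = b) by now rewrite comp_assoc, hh.
    exists (h ∘ q). split; [split; [exact hb|]|].
    + apply hm. now rewrite comp_assoc, hb.
    + intros d' [hd' _]. apply hm. now rewrite hb.
Qed.
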